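(* Running maximum e-BH, applied to arbitrarily dependent $e$-processes, does not provide FDR control at level $\alpha$. Precisely: for every $\alpha\in(0,1)$ there exist an integer $K\ge 1$, a measurable space $(\Omega,\mathcal F)$ with a filtration $(\mathcal F_t)_{t\ge 0}$ (discrete time), hypotheses $H_1,\dots,H_K$ (sets of probability measures on $(\Omega,\mathcal F)$), processes $(E^k_t)_{t\ge 0}$, $k=1,\dots,K$, each $E^k$ being an $e$-process for $H_k$ with respect to $(\mathcal F_t)$, a true data-generating probability measure $P^*$, and a time $t\ge 1$, such that, with $M^k_t=\max_{1\le s\le t}E^k_s$ and with $\mathcal R_t$ the set of hypotheses rejected by the e-BH procedure at level $\alpha$ applied to $(M^1_t,\dots,M^K_t)$, $$\mathbb E_{P^*}\left[\frac{|\mathcal R_t\cap\mathcal N|}{|\mathcal R_t|\vee 1}\right]>\alpha,$$ where $\mathcal N=\{k: P^*\in H_k\}$.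
   Context: Hypotheses are sets of probability measures; $H_k$ is true if $P^*\in H_k$, and $\mathcal N$ is the set of indices of true hypotheses. An $e$-process for a hypothesis $H$ with respect to a filtration $(\mathcal F_t)_{t\ge0}$ is a nonnegative process $(E_t)_{t\ge 0}$ adapted to $(\mathcal F_t)$, with $E_0=1$, such that $\mathbb E_P[E_\tau]\le 1$ for every (finite) stopping time $\tau$ and every $P\in H$. All $e$-processes are adapted to one common filtration; their joint dependence is otherwise arbitrary. e-BH procedure at level $\alpha$ applied to $(x_1,\dots,x_K)\in[0,\infty]^K$: let $x_{[1]}\ge\dots\ge x_{[K]}$ be the values sorted from largest to smallest, let $k^*=\max\{k\in\{1,\dots,K\}: x_{[k]}\ge K/(\alpha k)\}$, and reject the $k^*$ hypotheses with the largest values (reject none if the set is empty). The FDR of a random rejection set $\mathcal R$ is $\mathbb E_{P^*}[|\mathcal R\cap\mathcal N|/(|\mathcal R|\vee 1)]$. *)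

(* Defs.v *)
From mathcomp Require Import all_boot all_order all_algebra.
From mathcomp Require Import all_classical all_reals all_analysis.

Set Implicit Arguments.
Unset Strict Implicit.
Unset Printing Implicit Defensive.

Import Order.TTheory GRing.Theory Num.Theory.

Local Open Scope classical_set_scope.
Local Open Scope ring_scope.

Section Processes.
Context {d : measure_display} {T : measurableType d} {R : realType}.
Implicit Types (F : nat -> set (set T)) (X : nat -> T -> R).

Definition is_filtration F : Prop :=
  [/\ forall t, sigma_algebra [set: T] (F t),
      forall t, F t `<=` measurable &
      forall s t, (s <= t)%N -> F s `<=` F t].

Definition adapted F X : Prop :=
  forall t (B : set R), measurable B -> F t (X t @^-1` B).

(* Stopping times are finite, hence [nat]-valued. *)
Definition stopping_time F (tau : T -> nat) : Prop :=
  forall t, F t [set w | (tau w <= t)%N].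

Definition e_process F (H : set (probability T R)) X : Prop :=
  [/\ forall t w, 0 <= X t w,
      adapted F X,
      forall w, X 0%N w = 1 &
      forall (tau : T -> nat) (P : probability T R),
        stopping_time F tau -> H P ->
        ('E_P[fun w => X (tau w) w] <= 1)%E].

(* The maximum over 1 <= s <= t, so time 0 is excluded; -oo is neutral for
   the maximum and is only the actual value when t = 0. *)
Definition running_max X (t : nat) (w : T) : \bar R :=
  (\big[Order.max/-oo]_(1 <= s < t.+1) (X s w)%:E)%E.

End Processes.

Section EBH.
Context {R : realType} {K : nat}.
Implicit Types (alpha : R) (x : 'I_K -> \bar R).

Definition ebh_order x : seq 'I_K :=
  sort (fun i j => (x j <= x i)%E) (enum 'I_K).

(* x_[k], with k counted from 1 to K. *)
Definition kth_largest x (k : nat) : \bar R :=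
  nth -oo%E [seq x i | i <- ebh_order x] k.-1.

(* The maximum of an empty set of indices is 0: nothing is rejected then. *)
Definition ebh_kstar alpha x : nat :=
  (\max_(1 <= k < K.+1 |
         ((K%:R / (alpha * k%:R))%:E <= kth_largest x k)%E) k)%N.

(* Sorting breaks ties by index, but ties never straddle rank k*:
   if x_[k* + 1] were equal to x_[k*], it would also pass its (lower)
   threshold. *)
Definition ebh alpha x : {set 'I_K} :=
  [set i in take (ebh_kstar alpha x) (ebh_order x)]%SET.

End EBH.

Section FDR.
Context {d : measure_display} {T : measurableType d} {R : realType} {K : nat}.

Definition true_hypotheses (H : 'I_K -> set (probability T R))
    (P : probability T R) : {set 'I_K} :=
  [set k | `[< H k P >]]%SET.

Definition FDP (Rej N : {set 'I_K}) : R :=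
  #|Rej :&: N|%SET%:R / (maxn #|Rej| 1)%:R.

Definition FDR (P : probability T R) (Rej : T -> {set 'I_K})
    (N : {set 'I_K}) : \bar R :=
  ('E_P[fun w => FDP (Rej w) N])%E.

End FDR.

(* Main.v *)
Require Import Defs.
From mathcomp Require Import all_boot all_order all_algebra.
From mathcomp Require Import all_classical all_reals all_analysis.
From HB Require Import structures.
From mathcomp Require Import measurable_realfun ring lra.
Import Order.TTheory GRing.Theory Num.Theory.
Local Open Scope classical_set_scope.
Local Open Scope ring_scope.

(** The counterexample has two hypotheses, both true, tested by two gamblers who
bet with capitals E^1 and E^2 on the same two-step experiment.  As every
hypothesis is true, the FDR is the probability that something is rejected.  With
K = 2 this happens as soon as one running maximum reaches 2/alpha or both reach
1/alpha.

At time 1 the first gambler moves to 1/alpha with probability alpha and to 0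
otherwise, while the second one waits at 1.
- If the first gambler moved up, it tries to double at fair odds.  The second
  gambler bets that this fails, and reaches 1/alpha with conditional probability
  q on a part of that failure event.
- If the first gambler is ruined, the second one bets at fair odds on reaching
  2/alpha, which happens with conditional probability alpha/2.

When the first gambler fails to double, E^1 drops to 0 but its running maximum
stays at 1/alpha, so the later success of the second gambler (a relay) completes
the pair: the two maxima are both 1/alpha, although the two capitals are never
both that high at one time.  The relay is disjoint from the event that the first
gambler doubles, so the probability of a rejection is

  alpha (1/2 + q) + (1 - alpha) alpha/2 = alpha + alpha (q - alpha/2).

The second capital is a supermartingale iff q <= alpha, the relay fits in the
failure event iff q <= 1/2, and the FDR exceeds alpha iff q > alpha/2.  The
choice q = alpha/(1 + alpha) meets the three conditions for all alpha in (0,1).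

[supermartingale_e_process] turns the conditional inequalities at times 0 and 1
into the e-process property, [win_rejects] finds the outcomes with a rejection,
and [finite_support_probability] reduces all expectations to sums. *)

(** * Filtrations and probabilities on finitely many outcomes *)

(** Symmetry of [e] gives the closure under complements.  For an equivalence
relation these sets are the unions of classes: the events that are known when
[e]-related outcomes cannot be told apart. *)
Lemma saturated_sigma_algebra (T : Type) (e : T -> T -> Prop) :
  (forall w w', e w w' -> e w' w) ->
  sigma_algebra [set: T] [set A | forall w w', e w w' -> A w -> A w'].
Proof.
move=> e_sym; split=> /=.
- by [].
- move=> A satA w w' eww' [_ nAw]; split=> // Aw'.
  by apply: nAw; apply: satA Aw'; exact: e_sym.
- by move=> A satA w w' eww' [i _ Aiw]; exists i => //; exact: satA Aiw.
Qed.

(** [P] is the sum of the Dirac masses at the entries of [s], weighted by [p]. *)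
Lemma finite_support_probability (R : realType) d (T : measurableType d)
    (s : seq T) (p : T -> R) :
  (forall w, 0 <= p w) -> \sum_(w <- s) p w = 1 ->
  exists P : probability T R, forall f : T -> R,
    measurable_fun [set: T] f -> (forall w, 0 <= f w) ->
    ('E_P[f] = (\sum_(w <- s) p w * f w)%:E)%E.
Proof.
move=> p_ge0 p_sum1.
pose m (n : nat) : {measure set T -> \bar R} :=
  mscale (NngNum (p_ge0 (nth point s n))) \d_(nth point s n).
have mT : msum m (size s) [set: T] = 1%E.
  rewrite /msum -p_sum1 (big_nth point) big_mkord -sumEFin.
  by apply: eq_bigr => i _; rewrite /m/= /mscale/= diracT mule1.
pose isP := Measure_isProbability.Build _ _ _ (msum m (size s)) mT.
pose P : probability T R := HB.pack (msum m (size s)) isP.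
exists P => f mf f_ge0.
have /measurable_EFinP mf' := mf.
rewrite unlock.
transitivity (\int[msum m (size s)]_w (EFin \o f) w)%E; first by [].
rewrite (ge0_integral_measure_sum _ measurableT _ mf'); last first.
  by move=> w _; rewrite lee_fin.
rewrite (big_nth point) big_mkord -sumEFin; apply: eq_bigr => i _.
rewrite ge0_integral_mscale//; last by move=> w _; rewrite /= lee_fin.
by rewrite integral_dirac//= diracT mul1e EFinM.
Qed.

(** * The e-BH procedure *)

Lemma le_running_max d (T : measurableType d) (R : realType)
    (X : nat -> T -> R) (s t : nat) (w : T) :
  (1 <= s <= t)%N -> ((X s w)%:E <= running_max X t w)%E.
Proof.
move=> /andP[s1 st]; rewrite /running_max.
apply: (le_bigmax_seq _ _ xpredT (fun s => (X s w)%:E)) => //.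
by rewrite mem_index_iota s1 ltnS.
Qed.

(** If the [k]-th largest value were below [c], then so would be all later ones,
and the elements of [S] would fit in the first [k - 1] places. *)
Lemma kth_largest_ge (R : realType) (K : nat) (x : 'I_K -> \bar R)
    (k : nat) (c : \bar R) (S : {set 'I_K}) :
  (0 < k <= #|S|)%N -> (forall i, i \in S -> (c <= x i)%E) ->
  (c <= kth_largest x k)%E.
Proof.
move=> /andP[k0 kS] cx; rewrite /kth_largest leNgt; apply/negP => ltc.
pose r : rel 'I_K := fun i j => (x j <= x i)%E.
have r_tot : total r by move=> i j; exact: le_total.
have r_tr : transitive r by move=> j i l /= ij jl; exact: le_trans jl ij.
have s_ord : size (ebh_order x) = K by rewrite size_sort size_enum_ord.
have SK : (#|S| <= K)%N by rewrite -[leqRHS]card_ord max_card.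
have /subset_leq_card : S \subset [set i in take k.-1 (ebh_order x)]%SET.
  apply/fintype.subsetP => i iS; rewrite inE.
  have : i \in ebh_order x by rewrite mem_sort mem_enum.
  rewrite -{1}(cat_take_drop k.-1 (ebh_order x)) mem_cat => /orP[//|].
  move=> /(nthP i)[j]; rewrite size_drop s_ord nth_drop => jlt ij.
  have jK : (k.-1 + j < K)%N by rewrite -ltn_subRL.
  have kK : (k.-1 < K)%N by apply: leq_ltn_trans jK; rewrite leq_addr.
  have : r (nth i (ebh_order x) k.-1) i.
    rewrite -[X in r _ X]ij.
    apply: (@sorted_leq_nth _ r) => //.
    - by move=> l; exact: le_refl.
    - exact: sort_sorted.
    - by rewrite inE s_ord.
    - by rewrite inE s_ord.
    - by rewrite leq_addr.
  rewrite /r => xi.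
  move: ltc; rewrite (nth_map i) ?s_ord// => ltc.
  by have := lt_le_trans (le_lt_trans xi ltc) (cx i iS); rewrite ltxx.
rewrite cardsE => /leq_trans/(_ (card_size _)).
rewrite size_take s_ord.
have -> : (k.-1 < K)%N by rewrite prednK// (leq_trans kS).
by rewrite leqNgt prednK// kS.
Qed.

Lemma ebh_neq0 (R : realType) (K : nat) (alpha : R) (x : 'I_K -> \bar R)
    (k : nat) (S : {set 'I_K}) :
  (0 < k <= #|S|)%N ->
  (forall i, i \in S -> ((K%:R / (alpha * k%:R))%:E <= x i)%E) ->
  ebh alpha x != finset.set0.
Proof.
move=> kS xS; have ck := @kth_largest_ge _ _ _ _ _ _ kS xS.
have /andP[k0 kleS] := kS.
have kK : (k <= K)%N by rewrite (leq_trans kleS)// -[leqRHS]card_ord max_card.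
have : (k <= ebh_kstar alpha x)%N.
  rewrite /ebh_kstar.
  apply: (leq_bigmax_seq (F := id)) => //.
  by rewrite mem_index_iota k0 ltnS.
move=> kstar; have : (0 < size (take (ebh_kstar alpha x) (ebh_order x)))%N.
  rewrite size_take_min size_sort size_enum_ord leq_min.
  by rewrite (leq_trans k0 kstar) (leq_trans k0 kK).
case E: (take _ _) => [//|i s'] _.
by apply/set0Pn; exists i; rewrite inE E mem_head.
Qed.

Lemma FDP_ge0 (R : realType) (K : nat) (Rej N : {set 'I_K}) :
  0 <= FDP Rej N :> R.
Proof. by rewrite /FDP divr_ge0. Qed.

Lemma FDP_all_true (R : realType) (K : nat) (Rej : {set 'I_K}) :
  Rej != finset.set0 -> FDP Rej [set: 'I_K]%SET = 1 :> R.
Proof.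
rewrite -card_gt0 => Rej0; rewrite /FDP finset.setIT.
by rewrite (maxn_idPl Rej0) divff// pnatr_eq0 -lt0n.
Qed.

(** * The experiment *)

(** The first gambler doubles in [FirstWins]; in [Relay] and [BothCrash] it
falls from 1/alpha to 0 while the second gambler succeeds or fails; it is ruined
at time 1 in [SecondWins] and [NoneWins]. *)
Inductive outcome :=
  | FirstWins | Relay | BothCrash | SecondWins | NoneWins.

HB.instance Definition _ := gen_eqMixin outcome.
HB.instance Definition _ := gen_choiceMixin outcome.
HB.instance Definition _ := isPointed.Build outcome NoneWins.
HB.instance Definition _ := @isMeasurable.Build default_measure_display
  outcome discrete_measurable discrete_measurable0
  discrete_measurableC discrete_measurableU.

Definition outcomes := [:: FirstWins; Relay; BothCrash; SecondWins; NoneWins].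

(** The only thing revealed at time 1: whether the first gambler moved up. *)
Definition up (w : outcome) : bool :=
  match w with FirstWins | Relay | BothCrash => true | _ => false end.

Definition indistinguishable (t : nat) (w w' : outcome) : Prop :=
  match t with 0%N => True | 1%N => up w = up w' | _ => w = w' end.

Definition info (t : nat) : set (set outcome) :=
  [set A | forall w w', indistinguishable t w w' -> A w -> A w'].

Lemma info_filtration : is_filtration info.
Proof.
split=> [t|t A _ //|s t st A As w w' iw].
- by apply: saturated_sigma_algebra; case: t => [|[|t]] w w' //= ->.
- by apply: As; case: t s st iw => [|[|t]] [|[|s]] //= _ ->.
Qed.

(** Stopping at time 0 is decided without information, and stopping at time 1
with the sole knowledge of [up]. *)
Lemma stopping_cases (tau : outcome -> nat) : stopping_time info tau ->
  (forall w, tau w = 0%N) \/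
  forall b, (forall w, up w = b -> tau w = 1%N) \/
            (forall w, up w = b -> (2 <= tau w)%N).
Proof.
move=> st.
have [[w0 t0]|n0] := pselect (exists w, tau w = 0%N).
  left=> w; apply/eqP; rewrite -leqn0.
  by apply: (st 0%N w0 w) => //=; rewrite t0.
have tau1 w : (1 <= tau w)%N.
  by rewrite lt0n; apply/eqP => t0; apply: n0; exists w.
right=> b.
have [[w0 [upw0 t1]]|n1] := pselect (exists w, up w = b /\ tau w = 1%N).
  left=> w upw; apply/eqP; rewrite eqn_leq tau1 andbT.
  by apply: (st 1%N w0 w) => /=; rewrite ?upw0 ?upw ?t1.
right=> w upw; rewrite ltn_neqAle tau1 andbT; apply/eqP => t1.
by apply: n1; exists w.
Qed.

(** * The two e-processes *)

Section Gamblers.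
Context {R : realType} (alpha : R).
Hypotheses (alpha_gt0 : 0 < alpha) (alpha_lt1 : alpha < 1).

(** Conditionally on [up], [FirstWins], [Relay] and [BothCrash] have
probabilities 1/2, q and 1/2 - q with q = alpha / (1 + alpha). *)
Definition weight (w : outcome) : R :=
  match w with
  | FirstWins => alpha / 2
  | Relay => alpha * (alpha / (1 + alpha))
  | BothCrash => alpha * ((1 - alpha) / (2 * (1 + alpha)))
  | SecondWins => (1 - alpha) * (alpha / 2)
  | NoneWins => (1 - alpha) * (1 - alpha / 2)
  end.

Definition capital1 (t : nat) (w : outcome) : R :=
  match t with
  | 0%N => 1
  | 1%N => if up w then alpha^-1 else 0
  | _ => if w is FirstWins then 2 / alpha else 0
  end.

Definition capital2 (t : nat) (w : outcome) : R :=
  match t with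
  | 0%N | 1%N => 1
  | _ => match w with
         | Relay => alpha^-1
         | SecondWins => 2 / alpha
         | _ => 0
         end
  end.

Lemma weight_ge0 w : 0 <= weight w.
Proof. have [a0 a1] := (alpha_gt0, alpha_lt1).
by case: w => /=; do ?[apply: mulr_ge0 | rewrite invr_ge0]; lra. Qed.

Let alpha_neq0 : alpha != 0. Proof. exact: lt0r_neq0. Qed.
Let alphaS_neq0 : 1 + alpha != 0. Proof. by apply: lt0r_neq0; rewrite addr_gt0. Qed.

Lemma sum_weight : \sum_(w <- outcomes) weight w = 1.
Proof. by rewrite /outcomes !big_cons big_nil /=; field. Qed.

(** [u] and [v] are the two values of [X] at time 1.  Optional stopping reduces to
three bounds because [X] is frozen from time 2 on: a stopping time that is not 0
stops at time 1 or at the frozen value, separately on [up] and its complement. *)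
Lemma supermartingale_e_process (P : probability outcome R)
    (X : nat -> outcome -> R) (u v : R) :
  (forall f : outcome -> R,
    measurable_fun [set: outcome] f -> (forall w, 0 <= f w) ->
    ('E_P[f] = (\sum_(w <- outcomes) weight w * f w)%:E)%E) ->
  (forall t w, 0 <= X t w) ->
  (forall w, X 0%N w = 1) ->
  (forall w, X 1%N w = if up w then u else v) ->
  (forall t w, X t.+2 w = X 2 w) ->
  weight FirstWins * X 2 FirstWins + weight Relay * X 2 Relay
    + weight BothCrash * X 2 BothCrash <= alpha * u ->
  weight SecondWins * X 2 SecondWins + weight NoneWins * X 2 NoneWins
    <= (1 - alpha) * v ->
  alpha * u + (1 - alpha) * v <= 1 ->
  e_process info [set P] X.
Proof.
move=> EP X_ge0 X0 X1 X2 Xup Xdown Xstart; split=> //.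
  move=> t B _ w w' /= iww'; have -> // : X t w = X t w'.
  by case: t iww' => [|[|t]] /=; [rewrite !X0|rewrite !X1 => ->|move=> ->].
move=> tau _ /stopping_cases tau_cases ->; rewrite EP// lee_fin.
case: tau_cases => [tau0|tau12].
  by under eq_bigr do rewrite tau0 X0 mulr1; rewrite sum_weight.
have wu : weight FirstWins + weight Relay + weight BothCrash = alpha.
  by rewrite /=; field.
have wd : weight SecondWins + weight NoneWins = 1 - alpha by rewrite /=; ring.
have Xge2 w n : (2 <= n)%N -> X n w = X 2 w.
  by case: n => [|[|n]] // _; exact: X2.
have up_le : weight FirstWins * X (tau FirstWins) FirstWins
    + weight Relay * X (tau Relay) Relay
    + weight BothCrash * X (tau BothCrash) BothCrash <= alpha * u.
  case: (tau12 true) => tau_up.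
    by rewrite !tau_up// !X1/= -!mulrDl wu.
  by rewrite !(Xge2 _ (tau _)) ?tau_up.
have down_le : weight SecondWins * X (tau SecondWins) SecondWins
    + weight NoneWins * X (tau NoneWins) NoneWins <= (1 - alpha) * v.
  case: (tau12 false) => tau_down.
    by rewrite !tau_down// !X1/= -!mulrDl wd.
  by rewrite !(Xge2 _ (tau _)) ?tau_down.
rewrite /outcomes !big_cons big_nil addr0.
apply: le_trans Xstart; apply: le_trans (lerD up_le down_le).
by rewrite !addrA.
Qed.

Definition capital (k : 'I_2) := if k == ord0 then capital1 else capital2.

Lemma capital_ge0 k t w : 0 <= capital k t w.
Proof.
rewrite /capital; case: ifP => _; case: t w => [|[|t]] [] //=;
  by rewrite ?invr_ge0 ?divr_ge0// ltW.
Qed.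

Lemma capital_e_process (P : probability outcome R) :
  (forall f : outcome -> R,
    measurable_fun [set: outcome] f -> (forall w, 0 <= f w) ->
    ('E_P[f] = (\sum_(w <- outcomes) weight w * f w)%:E)%E) ->
  forall k, e_process info [set P] (capital k).
Proof.
move=> EP k; have := capital_ge0 k; rewrite /capital.
case: ifP => _ ge0.
- apply: (@supermartingale_e_process _ _ alpha^-1 0) => //=.
  + by rewrite le_eqVlt; apply/orP; left; apply/eqP; field;
      rewrite alpha_neq0 alphaS_neq0.
  + by rewrite !mulr0 addr0 lexx.
  + by rewrite divff// mulr0 addr0 lexx.
- apply: (@supermartingale_e_process _ _ 1 1) => //=.
  + by move=> w; case: (up w).
  + (* this is q <= alpha, after simplification *)
    rewrite !mulr0 add0r addr0 mulrAC divff// mul1r mulr1.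
    rewrite ler_pdivrMr ?addr_gt0// mulrDr mulr1 lerDl.
    by rewrite mulr_ge0 ?ltW.
  + by rewrite le_eqVlt; apply/orP; left; apply/eqP; field.
  + by rewrite !mulr1 subrKC lexx.
Qed.

Lemma win_rejects (w : outcome) : w \in [:: FirstWins; Relay; SecondWins] ->
  ebh alpha (fun k => running_max (capital k) 2 w) != finset.set0.
Proof.
have reach k s c : (1 <= s <= 2)%N -> c = capital k s w ->
    (c%:E <= running_max (capital k) 2 w)%E.
  by move=> s12 ->; exact: le_running_max.
rewrite !inE => /or3P[] /eqP wE.
- apply: (@ebh_neq0 _ _ _ _ 1 [set ord0]%SET); first by rewrite cards1.
  move=> i /finset.set1P ->; apply: (reach _ 2%N) => //.
  by rewrite /capital eqxx wE /= mulr1.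
- (* the first maximum is attained at time 1, the second one at time 2 *)
  have thr : 2 / (alpha * 2) = alpha^-1 by field.
  apply: (@ebh_neq0 _ _ _ _ 2 [set: 'I_2]%SET); first by rewrite cardsT card_ord.
  move=> i _; case: (eqVneq i ord0) => [i0|/negPf i0].
  + by apply: (reach _ 1%N) => //; rewrite /capital i0 wE /= thr.
  + by apply: (reach _ 2%N) => //; rewrite /capital i0 wE /= thr.
- apply: (@ebh_neq0 _ _ _ _ 1 [set ord_max]%SET); first by rewrite cards1.
  move=> i /finset.set1P ->; apply: (reach _ 2%N) => //.
  by rewrite /capital wE /= mulr1.
Qed.

End Gamblers.

Theorem proposition1 (R : realType) (alpha : R)
    (alpha_gt0 : 0 < alpha) (alpha_lt1 : alpha < 1) :
  exists (K : nat) (d : measure_display) (Omega : measurableType d)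
         (F : nat -> set (set Omega))
         (H : 'I_K -> set (probability Omega R))
         (E : 'I_K -> nat -> Omega -> R)
         (Pstar : probability Omega R) (t : nat),
    [/\ (1 <= K)%N,
        is_filtration F,
        forall k : 'I_K, e_process F (H k) (E k),
        (1 <= t)%N &
        (alpha%:E < FDR Pstar
                        (fun w => ebh alpha (fun k => running_max (E k) t w))
                        (true_hypotheses H Pstar))%E].
Proof.
have [P EP] := @finite_support_probability R _ outcome outcomes (weight alpha)
  (weight_ge0 alpha alpha_gt0 alpha_lt1) (sum_weight alpha alpha_gt0).
exists 2%N, default_measure_display, outcome, info, (fun=> [set P]),
  (capital alpha), P, 2%N; split=> //.
- exact: info_filtration.
- exact: capital_e_process.
- have -> : true_hypotheses (fun=> [set P]) P = [set: 'I_2]%SET.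
    by apply/setP => k; rewrite !inE; apply/asboolP.
  rewrite /FDR EP//; last by move=> w; exact: FDP_ge0.
  rewrite lte_fin /outcomes !big_cons big_nil addr0.
  have FDP_win w : w \in [:: FirstWins; Relay; SecondWins] ->
      FDP (ebh alpha (fun k => running_max (capital alpha k) 2 w))
        [set: 'I_2]%SET = 1 :> R.
    by move=> w_win; apply: FDP_all_true; exact: win_rejects.
  rewrite (FDP_win FirstWins) ?(FDP_win Relay) ?(FDP_win SecondWins);
    rewrite ?inE ?eqxx ?orbT// !mulr1.
  (* the other two outcomes can only increase the FDR *)
  set f1 := FDP _ _; set f2 := FDP _ _.
  have f1_ge0 : 0 <= f1 by exact: FDP_ge0.
  have f2_ge0 : 0 <= f2 by exact: FDP_ge0.
  have /= b1 := mulr_ge0 (weight_ge0 alpha alpha_gt0 alpha_lt1 BothCrash) f1_ge0.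
  have /= b2 := mulr_ge0 (weight_ge0 alpha alpha_gt0 alpha_lt1 NoneWins) f2_ge0.
  have q_gt : alpha / 2 < alpha / (1 + alpha).
    by rewrite ltr_pM2l// ltf_pV2 ?posrE; lra.
  have : alpha * (alpha / 2) < alpha * (alpha / (1 + alpha)).
    by rewrite ltr_pM2l.
  rewrite /=; lra.
Qed.
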